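(* Let $$a^*(\tau)=\frac{1}{4(1+2\sqrt{\Delta}\,\tau)\left(1+\frac{\tau}{16\kappa}\right)}.$$ For any step size $\gamma=\frac{a}{4L}$ with $0<a\le a^*(\tau)$ and epoch size $m=\frac{32\kappa}{a}$, KROMAGNON converges geometrically in expectation with a rate factor per gradient computation of at least $\rho(a)=\frac14\min\{\frac1n,\frac{a}{64\kappa}\}$, i.e. $$\mathbb{E}f(\tilde x_k)-f(x^* )\le(1-\rho)^{k(2m+n)}\,(f(x_0)-f(x^* ))\qquad\forall k\ge0,$$ with $\rho=\rho(a)$.
   Context: Let $f(x)=\frac1n\sum_{i=1}^n f_i(x)$ on $\mathbb{R}^d$, where each $f_i$ is convex and differentiable with $L$-Lipschitz gradient $f_i'$, and $f$ is $\mu$-strongly convex ($\mu>0$). Let $\kappa:=L/\mu$ and let $x^*$ be the minimizer of $f$. $[x]_v$ denotes coordinate $v$ of $x$. For each $i$, $S_i\subseteq\{1,\dots,d\}$ is the support of $f_i'$, i.e. the set of coordinates where $f_i'$ can be nonzero. $P_{S_i}$ is the coordinate projection onto $S_i$; $p_v:=\frac1n|\{i:v\in S_i\}|$; $D$ is diagonal with entries $1/p_v$; $D_i:=P_{S_i}D$. The sparsity constant is $\Delta:=\frac1n\max_{v}|\{i:v\in S_i\}|\in[\frac1n,1]$. KROMAGNON (asynchronous parallel sparse SVRG; step size $\gamma$, epoch size $m$, a positive integer). Start from a deterministic $\tilde x_0=x_0$. Epoch $k=0,1,2,\dots$ consists of the iterations labeled $km\le t\le(k+1)m-1$. At its beginning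 all cores are synchronized, the full gradient $f'(\tilde x_k)$ is computed, and the shared memory vector $x$ is set to $\tilde x_k$. During the epoch, several cores repeat in parallel, without locks: read all coordinates of $x$ (possibly inconsistently, i.e. coordinates are read at different times while other cores write), giving $\hat x$; sample $i$ uniformly in $\{1,\dots,n\}$; compute $g=f_i'(\hat x)-f_i'(\tilde x_k)+D_if'(\tilde x_k)$; for each $v\in S_i$ atomically do $[x]_v\leftarrow[x]_v-\gamma[g]_v$. At the end of the epoch (all writes completed), $\tilde x_{k+1}$ is chosen uniformly at random among $\hat x_{km},\dots,\hat x_{(k+1)m-1}$. Each epoch uses $2m+n$ gradient computations. Labeling (''after read''): iterations are labeled $t$ in the order in which their reads are completed; $\hat x_t$, $i_t$, $g_t$ are the read vector, sampled index and computed direction of iteration $t$. $i_t$ is uniform on $\{1,\dots,n\}$ and independent of everything in the past of the completed read $t$ (all $\hat x_u$, $u\le t$, all $i_u$, $u<t$, and the $\tilde x_j$ chosen so far). Bounded overlap assumption with constant $\tau\ge0$ (integer): an iteration is being processed from the start of its read to the end of its writes, and iterations $r$ and $t$ are never processed concurrently when $r\ge t+\tau+1$. Hence, with virtual iterates defined within epoch $k$ by $x_{km}:=\tilde x_k$ and $x_{t+1}:=x_t-\gamma g_t$, one has $\hat x_t-x_t=\gamma\sum_{u=\max(km,\,t-\tau)}^{t-1}G_u^tg_u$ for $km\le t\le(k+1)m-1$, where $G_u^t$ are (random) diagonal matrices with entries in $\{0,1\}$. *)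

(* Defs.v *)
From HB Require Import structures.
From mathcomp Require Import all_boot all_order all_algebra.
From mathcomp Require Import all_classical all_reals all_analysis.

Set Implicit Arguments.
Unset Strict Implicit.
Unset Printing Implicit Defensive.

Import Order.TTheory GRing.Theory Num.Theory.
Import numFieldNormedType.Exports.

Local Open Scope classical_set_scope.
Local Open Scope ring_scope.

Section Objective.
Context {R : realType} {d n : nat}.
Implicit Types (h : 'rV[R]_d -> R) (f : 'I_n -> 'rV[R]_d -> R).

(* The library norm `|x| on 'rV[R]_d is the sup norm; Lipschitz continuity and
   strong convexity below refer to the Euclidean norm. *)
Definition norm2 (x : 'rV[R]_d) : R := Num.sqrt (\sum_(v < d) x 0 v ^+ 2).

Definition grad h (x : 'rV[R]_d) : 'rV[R]_d :=
  \row_(v < d) 'd h x (delta_mx 0 v).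

Definition lipschitz_grad (L : R) h : Prop :=
  forall x y, norm2 (grad h x - grad h y) <= L * norm2 (x - y).

Definition strongly_convex (mu : R) h : Prop :=
  forall (x y : 'rV[R]_d) (s : R), 0 <= s <= 1 ->
    h (s *: x + (1 - s) *: y) <=
      s * h x + (1 - s) * h y - mu / 2 * s * (1 - s) * norm2 (x - y) ^+ 2.

Definition favg f (x : 'rV[R]_d) : R := n%:R^-1 * \sum_(i < n) f i x.

Definition gsupp f (i : 'I_n) : {set 'I_d} :=
  [set v | `[< exists x, grad (f i) x 0 v != 0 >]]%SET.

Definition supp_card f (v : 'I_d) : nat := #|[set i | v \in gsupp f i]%SET|.

Definition pfreq f (v : 'I_d) : R := n%:R^-1 * (supp_card f v)%:R.

(* The sparsity constant Delta. *)
Definition sparsity f : R := n%:R^-1 * (\max_(v < d) supp_card f v)%:R.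

Definition proj_supp f (i : 'I_n) : 'M[R]_d :=
  diag_mx (\row_(v < d) (v \in gsupp f i)%:R).

(* If pfreq f v = 0 then the v-th entry is 0^-1 = 0; it is irrelevant, since
   such a v belongs to no support and is killed by every proj_supp f i. *)
Definition Dmx f : 'M[R]_d := diag_mx (\row_(v < d) (pfreq f v)^-1).

Definition Dimx f (i : 'I_n) : 'M[R]_d := proj_supp f i *m Dmx f.

(* Diagonal matrices act on row vectors from the right. *)
Definition svrg_dir f (i : 'I_n) (xh xt : 'rV[R]_d) : 'rV[R]_d :=
  grad (f i) xh - grad (f i) xt + grad (favg f) xt *m Dimx f i.

End Objective.

Section Kromagnon.
Context {R : realType} {disp : measure_display} {T : measurableType disp}.
Context {d n m : nat}.

(* A run, as a family of random quantities on T. Iteration t belongs to epoch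
   t %/ m. Time is real; none of the time stamps is assumed measurable, and
   nothing is assumed about their dependence on the sampled indices beyond
   the field rr_sample below. *)
Record run := Run {
  xtilde : nat -> T -> 'rV[R]_d;
  xhat   : nat -> T -> 'rV[R]_d;
  idx    : nat -> T -> 'I_n;
  chosen : nat -> T -> 'I_m;            (* position of xtilde k.+1 in epoch k *)
  read_start : nat -> T -> R;
  read_at    : nat -> 'I_d -> T -> R;   (* when coordinate v is read *)
  read_end   : nat -> T -> R;
  write_at   : nat -> 'I_d -> T -> R;   (* when coordinate v is updated; only
                                           meaningful for v in the support *)
  write_end  : nat -> T -> R }.

Section Execution.
Variables (f : 'I_n -> 'rV[R]_d -> R) (gamma : R) (K : run).

Definition direction (t : nat) (w : T) : 'rV[R]_d :=
  svrg_dir f (idx K t w) (xhat K t w) (xtilde K (t %/ m) w).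

(* Coordinate v of the shared memory at time s of epoch k: the initial value
   xtilde k after all the atomic updates of the epoch performed before s. *)
Definition memory (k : nat) (s : R) (v : 'I_d) (w : T) : R :=
  xtilde K k w 0 v -
    \sum_(k * m <= u < k.+1 * m |
          (v \in gsupp f (idx K u w)) && (write_at K u v w < s))
       gamma * direction u w 0 v.

Record execution (x0 : 'rV[R]_d) : Prop := Execution {
  exec_init : forall w, xtilde K 0 w = x0;
  exec_epoch : forall k w, xtilde K k.+1 w = xhat K (k * m + chosen K k w) w;
  exec_read : forall t v w,
    xhat K t w 0 v = memory (t %/ m) (read_at K t v w) v w;
  exec_read_time : forall t v w,
    read_start K t w <= read_at K t v w <= read_end K t w;
  exec_write_time : forall t v w, v \in gsupp f (idx K t w) ->
    read_end K t w <= write_at K t v w <= write_end K t w;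
  exec_time : forall t w,
    read_start K t w <= read_end K t w <= write_end K t w;
  exec_sync : forall t u w, (t %/ m < u %/ m)%N ->
    write_end K t w < read_start K u w;
  exec_label : forall t u w, (t <= u)%N -> read_end K t w <= read_end K u w }.

End Execution.

Definition processed (K : run) (t : nat) (w : T) (s : R) : Prop :=
  read_start K t w <= s <= write_end K t w.

Definition bounded_overlap (tau : nat) (K : run) : Prop :=
  forall (t r : nat) (w : T), (t + tau + 1 <= r)%N ->
    ~ exists s, processed K t w s /\ processed K r w s.

(* The sigma-algebra generated by the xhat u with u < a, the idx u with u < b
   and the xtilde j with j < c. *)
Definition history (K : run) (a b c : nat) : set (set T) :=
  <<s [set A | (exists u v (B : set R), [/\ (u < a)%N, measurable B &
                  A = [set w | B (xhat K u w 0 v)]])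
            \/ (exists u i, (u < b)%N /\ A = [set w | idx K u w = i])
            \/ (exists j v (B : set R), [/\ (j < c)%N, measurable B &
                  A = [set w | B (xtilde K j w 0 v)]])] >>.

Definition uniform_indep (P : probability T R) (N : nat) (X : T -> 'I_N)
    (H : set (set T)) : Prop :=
  (forall i, P [set w | X w = i] = (N%:R^-1)%:E) /\
  (forall A i, H A ->
     P (A `&` [set w | X w = i]) = (P A * P [set w | X w = i])%E).

Record random_run (P : probability T R) (K : run) : Prop := RandomRun {
  rr_xhat : forall t v, measurable_fun setT (fun w => xhat K t w 0 v);
  rr_idx : forall t i, measurable [set w | idx K t w = i];
  rr_chosen : forall k j, measurable [set w | chosen K k w = j];
  rr_sample : forall t,
    uniform_indep P (idx K t) (history K t.+1 t (t %/ m).+1);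
  rr_choice : forall k,
    uniform_indep P (chosen K k) (history K (k.+1 * m) (k.+1 * m) k.+1) }.

Record kromagnon (P : probability T R) (f : 'I_n -> 'rV[R]_d -> R)
    (gamma : R) (x0 : 'rV[R]_d) (tau : nat) (K : run) : Prop := Kromagnon {
  krom_exec : execution f gamma K x0;
  krom_overlap : bounded_overlap tau K;
  krom_random : random_run P K }.

End Kromagnon.
Arguments run {R disp} T d n m.

Definition a_star {R : realType} (Delta kappa : R) (tau : nat) : R :=
  1 / (4 * (1 + 2 * Num.sqrt Delta * tau%:R) * (1 + tau%:R / (16 * kappa))).

Definition rate {R : realType} (n : nat) (kappa a : R) : R :=
  1 / 4 * Num.min (n%:R^-1) (a / (64 * kappa)).

(* Main.v *)
(* Let z be the minimizer of f.  Work inside one epoch with the virtual iterates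
   x_(t+1) = x_t - gamma g_t.  Expanding |x_(t+1) - z|^2 leaves three terms.  The progress term
   <xhat_t - z, g_t> has mean at least E f(xhat_t) - f(z), since the SVRG
   direction is unbiased.  The energy E|g_t|^2 is at most 4L times the sum of the
   optimality gaps at xhat_t and at the snapshot, by cocoercivity and a variance
   bound for the correction D_i f'.  The delay term <xhat_t - x_t, g_t> is
   dominated by the products |g_u||g_t| with t - tau <= u < t, and since i_t is
   independent of g_u, AM-GM bounds each by sqrt(Delta)/2 (E|g_u|^2 + E|g_t|^2).
   Summing over the epoch with gamma, m as prescribed contracts the gap of the
   snapshot by 2/7 <= 1/2, and (1 - rho)^(2m+n) >= 1/2 by Bernoulli's inequality.
   Unlike in the usual argument, no bound on E|xhat_t - x_t|^2 is needed, because
   the strong convexity term of the progress is dropped; strong convexity enters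
   only through |x - z|^2 <= (2/mu) (f(x) - f(z)) at the snapshot.

   Reads and updates involve finitely many discrete choices, so all iterates take
   finitely many values: every random variable is simple, and integrability and
   joint measurability come for free. *)
Require Import Defs.
From HB Require Import structures.
From mathcomp Require Import all_boot all_order all_algebra.
From mathcomp Require Import all_classical all_reals all_analysis.
From mathcomp Require Import ring lra zify.

Import Order.TTheory GRing.Theory Num.Theory.
Import numFieldNormedType.Exports.

Local Open Scope classical_set_scope.
Local Open Scope ring_scope.

(** * Smooth convex functions *)

Section InnerProduct.
Context {R : realType} {d : nat}.
Implicit Types (x y z : 'rV[R]_d) (c : R).

Definition dotp x y : R := \sum_(v < d) x 0 v * y 0 v.
Definition sqn x : R := dotp x x.

Lemma dotpC x y : dotp x y = dotp y x.
Proof. by apply: eq_bigr => v _; rewrite mulrC. Qed.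

Lemma dotpDl x y z : dotp (x + y) z = dotp x z + dotp y z.
Proof. by rewrite -big_split; apply: eq_bigr => v _; rewrite mxE mulrDl. Qed.

Lemma dotpZl c x y : dotp (c *: x) y = c * dotp x y.
Proof. by rewrite mulr_sumr; apply: eq_bigr => v _; rewrite mxE mulrA. Qed.

Lemma dotpNl x y : dotp (- x) y = - dotp x y.
Proof. by rewrite -scaleN1r dotpZl mulN1r. Qed.

Lemma dotpBl x y z : dotp (x - y) z = dotp x z - dotp y z.
Proof. by rewrite dotpDl dotpNl. Qed.

Lemma dotp0l x : dotp 0 x = 0.
Proof. by rewrite -(scale0r 0) dotpZl mul0r. Qed.

Lemma dotpDr x y z : dotp z (x + y) = dotp z x + dotp z y.
Proof. by rewrite dotpC dotpDl !(dotpC z). Qed.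

Lemma dotpZr c x y : dotp y (c *: x) = c * dotp y x.
Proof. by rewrite dotpC dotpZl (dotpC y). Qed.

Lemma dotpNr x y : dotp y (- x) = - dotp y x.
Proof. by rewrite dotpC dotpNl (dotpC y). Qed.

Lemma dotpBr x y z : dotp z (x - y) = dotp z x - dotp z y.
Proof. by rewrite dotpDr dotpNr. Qed.

Lemma dotp_suml I (r : seq I) (F : I -> 'rV[R]_d) y :
  dotp (\sum_(i <- r) F i) y = \sum_(i <- r) dotp (F i) y.
Proof.
by elim/big_rec2: _ => [|i a x _ <-]; rewrite ?dotp0l ?dotpDl.
Qed.

Lemma sqn_ge0 x : 0 <= sqn x.
Proof. by apply: sumr_ge0 => v _; rewrite -expr2 sqr_ge0. Qed.

Lemma norm2_sqr x : norm2 x ^+ 2 = sqn x.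
Proof.
rewrite /norm2 sqr_sqrtr; first by apply: eq_bigr => v _; rewrite expr2.
by apply: sumr_ge0 => v _; exact: sqr_ge0.
Qed.

Lemma sqnD x y : sqn (x + y) = sqn x + 2 * dotp x y + sqn y.
Proof. by rewrite /sqn !(dotpDl, dotpDr) (dotpC y x); ring. Qed.

Lemma sqnN x : sqn (- x) = sqn x.
Proof. by rewrite /sqn dotpNl dotpNr opprK. Qed.

Lemma sqnB x y : sqn (x - y) = sqn x - 2 * dotp x y + sqn y.
Proof. by rewrite sqnD sqnN dotpNr mulrN. Qed.

Lemma sqnZ c x : sqn (c *: x) = c ^+ 2 * sqn x.
Proof. by rewrite /sqn dotpZl dotpZr mulrA. Qed.

Lemma sqnB_le x y : sqn (x - y) <= 2 * sqn x + 2 * sqn y.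
Proof. by have := sqn_ge0 (x + y); rewrite sqnB sqnD; lra. Qed.

(** Cauchy-Schwarz without square roots, read off from [0 <= sqn (x - c *: y)]. *)
Lemma dotp_le_of_sqn {x y} c : 0 < c -> sqn x <= c ^+ 2 * sqn y ->
  dotp x y <= c * sqn y.
Proof.
move=> c0 xy; rewrite -(ler_pM2l c0).
by have := sqn_ge0 (x - c *: y); rewrite sqnB sqnZ dotpZr expr2; lra.
Qed.

End InnerProduct.

(** * Gradient inequalities for smooth and strongly convex functions *)

Section SmoothConvex.
Context {R : realType} {d : nat}.
Implicit Types (L mu : R) (h : 'rV[R]_d -> R) (x y v : 'rV[R]_d).

Lemma gradE h x (j : 'I_d) : grad h x 0 j = 'd h x (delta_mx 0 j).
Proof. by rewrite mxE. Qed.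

Lemma diff_dotp_grad h x v : 'd h x v = dotp (grad h x) v.
Proof.
rewrite [in LHS](row_sum_delta v) linear_sum; apply: eq_bigr => j _.
by rewrite linearZ/= mxE mulrC.
Qed.

Lemma is_derive_line h x v (s : R) : (forall z, differentiable h z) ->
  is_derive s 1 (fun s : R => h (x + s *: v)) (dotp (grad h (x + s *: v)) v).
Proof.
move=> dh.
have dl : is_diff s (fun s : R => x + s *: v) (0 + ( *:%R ^~ v)).
  exact: (@is_diffD _ _ _ (cst x) (fun s : R => s *: v)).
have dh' := differentiableP (dh (x + s *: v)).
have dc : is_diff s (h \o (fun s : R => x + s *: v))
   ('d h (x + s *: v) \o (0 + ( *:%R ^~ v))) by exact: is_diff_comp.
have df : differentiable (h \o (fun s : R => x + s *: v)) s := ex_diff.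
apply: DeriveDef; first exact/derivable1_diffP.
by rewrite deriveE// diff_val/= -diff_dotp_grad; congr ('d _ _ _);
  rewrite !fctE/= add0r scale1r.
Qed.

(** Strong convexity on the segment from [x] to [y] bounds the difference quotient of [h] at [x];
    dividing by the weight [s] and letting [s] tend to 0 from the right turns the quotient into the
    directional derivative. *)
Lemma strongly_convex_first_order mu h x y :
  (forall z, differentiable h z) -> strongly_convex mu h ->
  h x + dotp (grad h x) (y - x) + mu / 2 * sqn (y - x) <= h y.
Proof.
move=> dh sc; set v := y - x.
have := is_derive_line h x v 0 dh; rewrite scale0r addr0 => -[].
set phi := fun s : R => h (x + s *: v) => dphi Dphi.
have quo : s^-1 *: (phi (s + 0) - phi 0) @[s --> 0^'+] --> dotp (grad h x) v.
  apply: cvg_dnbhs_at_right; rewrite -Dphi.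
  (* The derivative in direction 1 has increments [s *: 1]; these are rewritten to [s]. *)
  move: dphi => /cvg_ex[l cl]; rewrite /derive.
  have := cl; rewrite -(cvg_lim _ cl)//.
  set A := (X in X @ _ --> _ -> _); set B := (X in _ -> X @ _ --> _).
  by have -> : B = A by apply/funext => s; rewrite /A/B/= scaler1.
have bnd : h y - h x - mu / 2 * (1 - s) * sqn v @[s --> (0:R)^'+]
    --> h y - h x - mu / 2 * (1 - 0) * sqn v.
  apply: cvg_at_right_filter; apply: cvgB; first exact: cvg_cst.
  apply: cvgM; last exact: cvg_cst.
  apply: cvgM; first exact: cvg_cst.
  by apply: cvgB; [exact: cvg_cst|exact: cvg_id].
suff : dotp (grad h x) v <= h y - h x - mu / 2 * (1 - 0) * sqn v by lra.
apply: (ler_cvg_to quo bnd); near=> s.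
have s0 : 0 < s by near: s; exact: nbhs_right_gt.
have s1 : s <= 1 by near: s; apply: nbhs_right_le.
have := sc y x s; rewrite norm2_sqr -/v (ltW s0) s1 => /(_ isT).
have -> : s *: y + (1 - s) *: x = x + s *: v.
  by rewrite /v scalerBr scalerBl scale1r addrCA; congr (_ + _); rewrite addrC.
move=> H; rewrite addr0 /phi scale0r addr0 /GRing.scale/= -(ler_pM2l s0).
rewrite mulrA divff ?gt_eqF// mul1r.
by apply: le_trans (lerB H (lexx (h x))) _;
  rewrite le_eqVlt; apply/orP; left; apply/eqP; field.
Unshelve. all: end_near. Qed.

Lemma convex_strongly0 h : convex_function setT h -> strongly_convex 0 h.
Proof.
move=> ch x y s /[dup] s01 /andP[s0 s1].
have := ch (Itv01 s0 s1) x y; rewrite !in_setT => /(_ isT isT).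
by rewrite !mul0r subr0.
Qed.

Lemma lipschitz_grad_sqn {L h} : 0 <= L -> lipschitz_grad L h ->
  forall x y, sqn (grad h x - grad h y) <= L ^+ 2 * sqn (x - y).
Proof.
move=> L0 lip x y; rewrite -!norm2_sqr -exprMn lerXn2r ?nnegrE//.
  exact: sqrtr_ge0.
by rewrite mulr_ge0// sqrtr_ge0.
Qed.

(** The mean value theorem is applied on [0, 1] to [phi - psi], where [psi] is the quadratic with
    slope [p + L * b * s]; by the Lipschitz bound this slope dominates the derivative of [phi]. *)
Lemma lipschitz_grad_descent {L h} x y : 0 < L ->
  (forall z, differentiable h z) -> lipschitz_grad L h ->
  h y <= h x + dotp (grad h x) (y - x) + L / 2 * sqn (y - x).
Proof.
move=> L0 dh lip; set v := y - x.
pose phi (s : R) := h (x + s *: v).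
(* Naming these quantities through existentials makes them opaque, so that later steps treat them as
   atoms. *)
have [q qE] : exists q : R -> R, forall s, q s = dotp (grad h (x + s *: v)) v.
  by exists (fun s => dotp (grad h (x + s *: v)) v).
have dphi (s : R) : is_derive s 1 phi (q s).
  by rewrite qE; exact: is_derive_line.
have [p pE] : exists p : R, p = dotp (grad h x) v by eexists.
have [b bE] : exists b : R, b = sqn v by eexists.
pose psi (s : R) := p * s + L / 2 * b * s ^+ 2.
have dpsi (s : R) : is_derive s 1 psi (p + L * b * s).
  have -> : psi = (p \*: id) + ((L / 2 * b) \*: (id ^+ 2)) by apply/funext.
  by apply: is_derive_eq; rewrite /GRing.scale/= expr1; field.
have dd (s : R) : is_derive s (1 : R) (phi - psi) (q s - (p + L * b * s)).
  exact: is_deriveB.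
have [|s /itvP s01 E] := MVT (@ltr01 R) (fun s _ => dd s).
  apply: derivable_within_continuous => s _; exact: ex_derive.
have {E} : h y - (p + L / 2 * b) - h x = q s - (p + L * b * s).
  move: E; rewrite !fctE /phi /psi scale0r scale1r addr0 [x + v]addrC subrK => E.
  by rewrite -[RHS]mulr1 -[in RHS](subr0 1) -E; ring.
have : q s - p <= L * s * b.
  rewrite qE pE bE -dotpBl; apply: dotp_le_of_sqn; first by rewrite mulr_gt0// s01.
  apply: le_trans (lipschitz_grad_sqn (ltW L0) lip _ _) _.
  by rewrite addrAC subrr add0r sqnZ exprMn mulrA.
rewrite -pE -bE; move: (q s) (h x) (h y) => {qE dphi dpsi dd phi psi pE bE} r e g.
by move=> H H'; lra.
Qed.

(** The algebra behind cocoercivity: [a], [p] stand for the value and gradient at [x], and [c], [q]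
    for those at [y]. *)
Lemma cocoercivity_step L (a c : R) (p q g x y : 'rV[R]_d) : 0 < L ->
  g = p - q ->
  c + dotp q (x - L^-1 *: g - y) <=
    a + dotp p (x - L^-1 *: g - x) + L / 2 * sqn (x - L^-1 *: g - x) ->
  sqn g <= 2 * L * (a - c - dotp q (x - y)).
Proof.
move=> L0 gE.
have -> : x - L^-1 *: g - y = (x - y) - L^-1 *: g by rewrite addrAC.
have -> : x - L^-1 *: g - x = - (L^-1 *: g) by rewrite addrAC subrr add0r.
rewrite sqnN sqnZ (dotpBr (x - y)) dotpNr !dotpZr.
have -> : dotp p g = dotp q g + sqn g.
  by rewrite /sqn {3}gE dotpBl addrC subrK.
have L0' : L != 0 by rewrite gt_eqF.
have -> : L / 2 * (L^-1 ^+ 2 * sqn g) = L^-1 * sqn g / 2 by field.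
move: (sqn g) (dotp q (x - y)) (dotp q g) => s t u {gE} H.
have : L^-1 * s <= 2 * (a - c - t).
  by move: H; rewrite mulrDr; move: (L^-1 * s) (L^-1 * u) => k l; lra.
by rewrite -(ler_pM2l L0) mulrA divff// mul1r mulrA [L * 2]mulrC.
Qed.

Lemma cocoercivity {L h} x y : 0 < L -> convex_function setT h ->
  (forall z, differentiable h z) -> lipschitz_grad L h ->
  sqn (grad h x - grad h y) <= 2 * L * (h x - h y - dotp (grad h y) (x - y)).
Proof.
move=> L0 /convex_strongly0 ch dh lip.
(* This point minimizes the quadratic upper model of [h] at [x] minus its affine lower model at
   [y]. *)
pose z := x - L^-1 *: (grad h x - grad h y).
have := lipschitz_grad_descent x z L0 dh lip.
have := strongly_convex_first_order 0 h y z dh ch.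
rewrite !mul0r addr0 => lo /(le_trans lo).
exact: cocoercivity_step.
Qed.

(** Fermat's rule along each coordinate line; the interval from -1 to 1 is an arbitrary
    neighbourhood of 0. *)
Lemma grad_min h x : (forall z, differentiable h z) ->
  (forall y, h x <= h y) -> grad h x = 0.
Proof.
move=> dh hmin; apply/rowP => v; rewrite gradE mxE diff_dotp_grad.
have := is_derive_line h x (delta_mx 0 v) 0 dh; rewrite scale0r addr0 => -[_ <-].
have [] // : is_derive (0 : R) 1 (fun s : R => h (x + s *: delta_mx 0 v)) 0.
apply: (@derive1_at_min _ _ (- 1) 1) => [|t _||t _].
- by lra.
- exact: (@ex_derive _ _ _ _ _ _ _ (is_derive_line h x (delta_mx 0 v) t dh)).
- by rewrite in_itv/=; lra.
- by rewrite scale0r addr0.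
Qed.

End SmoothConvex.

(** * Finite sums and the SVRG direction *)

Section FiniteSum.
Context {R : realType} {d n : nat} (f : 'I_n -> 'rV[R]_d -> R).
(* Testing convertibility of two distinct gradients unfolds the library's choice
   of a differential; locking keeps rewriting from doing so. *)
Definition lgrad : ('rV[R]_d -> R) -> 'rV[R]_d -> 'rV[R]_d := locked grad.

Lemma gradL : grad = lgrad. Proof. by rewrite /lgrad -lock. Qed.

Hypothesis n_gt0 : (0 < n)%N.
Hypothesis df : forall i x, differentiable (f i) x.

Let n_neq0 : n%:R != 0 :> R.
Proof. by rewrite pnatr_eq0 -lt0n. Qed.

Lemma favgE : favg f = n%:R^-1 *: \sum_(i < n) f i.
Proof. by apply/funext => x; rewrite /favg fctE fct_sumE. Qed.

Lemma differentiable_favg x : differentiable (favg f) x.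
Proof. by rewrite favgE; apply/differentiableZ/differentiable_sum. Qed.

Lemma diff_sum m (F : 'I_m -> 'rV[R]_d -> R) x v :
  (forall i, differentiable (F i) x) ->
  'd (\sum_(i < m) F i) x v = \sum_(i < m) 'd (F i) x v.
Proof.
elim: m F => [|m IH] F dF.
  by rewrite !big_ord0 -[0]/(cst 0 : 'rV[R]_d -> R) diff_cst.
by rewrite !big_ord_recl diffD//=; [rewrite IH|exact: differentiable_sum].
Qed.

Lemma grad_favg x : lgrad (favg f) x = n%:R^-1 *: \sum_(i < n) lgrad (f i) x.
Proof.
rewrite -gradL; apply/rowP => v; rewrite gradE favgE.
rewrite diffZ; last exact: differentiable_sum.
rewrite /= diff_sum// mxE summxE; congr (_ * _).
by apply: eq_bigr => i _; rewrite gradE.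
Qed.

Lemma pfreqE v : pfreq f v = n%:R^-1 * \sum_(i < n) (v \in gsupp f i)%:R :> R.
Proof.
rewrite /pfreq /supp_card; congr (_ * _).
by rewrite -sum1_card natr_sum big_mkcond/=; apply: eq_bigr => i _;
  rewrite inE; case: ifP.
Qed.

Lemma pfreq_le_sparsity v : pfreq f v <= sparsity f :> R.
Proof.
rewrite /pfreq /sparsity ler_wpM2l ?invr_ge0 ?ler0n// ler_nat.
exact: (leq_bigmax v).
Qed.

Lemma sparsity_ge0 : 0 <= sparsity f :> R.
Proof. by rewrite /sparsity mulr_ge0 ?invr_ge0 ?ler0n. Qed.

Lemma pfreq_gt0 i v : v \in gsupp f i -> 0 < pfreq f v :> R.
Proof.
move=> vi; rewrite /pfreq mulr_gt0 ?invr_gt0 ?ltr0n// card_gt0.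
by apply/set0Pn; exists i; rewrite inE.
Qed.

Lemma grad_notin_gsupp [i] x [v] : v \notin gsupp f i -> lgrad (f i) x 0 v = 0.
Proof.
rewrite inE gradL => /asboolPn H; apply/eqP; apply/negPn/negP => g0.
by apply: H; exists x.
Qed.

Lemma mulmx_Dimx i (x : 'rV[R]_d) v :
  (x *m Dimx f i) 0 v = (v \in gsupp f i)%:R * ((pfreq f v)^-1 * x 0 v).
Proof.
by rewrite /Dimx /proj_supp /Dmx mulmx_diag mul_mx_diag !mxE mulrC mulrA.
Qed.

Lemma svrg_dirE i a b v : svrg_dir f i a b 0 v =
  lgrad (f i) a 0 v - lgrad (f i) b 0 v +
  (v \in gsupp f i)%:R * ((pfreq f v)^-1 * lgrad (favg f) b 0 v).
Proof.
by rewrite /svrg_dir gradL -mulmx_Dimx; move: (lgrad _ a) (lgrad _ b) (_ *m _) => p q r;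
  rewrite !mxE.
Qed.

Lemma svrg_dir_notin_gsupp i a b v : v \notin gsupp f i ->
  svrg_dir f i a b 0 v = 0.
Proof.
move=> vi; rewrite svrg_dirE (negbTE vi) mul0r addr0.
by rewrite [X in X - _](grad_notin_gsupp a vi) [X in _ - X](grad_notin_gsupp b vi) subr0.
Qed.

Lemma grad_favgE x v :
  lgrad (favg f) x 0 v = n%:R^-1 * \sum_(i < n) lgrad (f i) x 0 v.
Proof. by rewrite grad_favg mxE summxE. Qed.

(** The cancellation survives [pfreq f v = 0]: then [v] lies in no support and the gradient
    coordinate is itself 0. *)
Lemma pfreqK x v :
  pfreq f v * ((pfreq f v)^-1 * lgrad (favg f) x 0 v) = lgrad (favg f) x 0 v.
Proof.
have [p0|p0] := eqVneq (pfreq f v : R) 0; last by rewrite mulVKf.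
rewrite p0 mul0r grad_favgE big1 ?mulr0// => i _; apply: grad_notin_gsupp.
by apply/negP => /pfreq_gt0; rewrite p0 ltxx.
Qed.

(** Unbiasedness. The support indicators of [v] average to [pfreq f v], which cancels the weight in
    [Dmx], so the mean correction is the full gradient at [b] and offsets the mean of the subtracted
    gradients. *)
Lemma svrg_dir_mean a b :
  n%:R^-1 *: \sum_(i < n) svrg_dir f i a b = lgrad (favg f) a.
Proof.
apply/rowP => v; rewrite mxE summxE; under eq_bigr do rewrite svrg_dirE.
rewrite !big_split/= sumrN -mulr_suml !mulrDr mulrN -!grad_favgE.
by rewrite mulrA -pfreqE pfreqK subrK.
Qed.

(** Coordinatewise variance identity. With [X i] the gradient difference, the mean of [X] is
    [p * q], so subtracting [q] on the support lowers the mean square by exactly [p * q ^+ 2]. *)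
Lemma svrg_correction_variance b x : lgrad (favg f) x = 0 ->
  n%:R^-1 * \sum_(i < n)
    sqn (lgrad (f i) b - lgrad (f i) x - lgrad (favg f) b *m Dimx f i) <=
  n%:R^-1 * \sum_(i < n) sqn (lgrad (f i) b - lgrad (f i) x).
Proof.
move=> gx0; rewrite ler_wpM2l ?invr_ge0 ?ler0n// /sqn /dotp.
rewrite exchange_big [leRHS]exchange_big/=; apply: ler_sum => v _.
have ninv : 0 < n%:R^-1 :> R by rewrite invr_gt0 ltr0n.
rewrite -(ler_pM2l ninv); set p : R := pfreq f v.
set q := p^-1 * lgrad (favg f) b 0 v.
pose X i := lgrad (f i) b 0 v - lgrad (f i) x 0 v.
have XE i : (lgrad (f i) b - lgrad (f i) x) 0 v = X i.
  by rewrite /X; move: (lgrad _ b) (lgrad _ x) => ? ?; rewrite !mxE.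
have YE i : (lgrad (f i) b - lgrad (f i) x - lgrad (favg f) b *m Dimx f i) 0 v =
    X i - (v \in gsupp f i)%:R * q.
  by rewrite -XE /q -mulmx_Dimx; move: (lgrad _ b - _) (_ *m _) => ? ?; rewrite !mxE.
have EX : n%:R^-1 * \sum_(i < n) X i = p * q.
  rewrite /X sumrB mulrBr -!grad_favgE gx0 [in X in _ - X]mxE subr0.
  by rewrite /q pfreqK.
(* The cross term carries no indicator because [X i] already vanishes off the support. *)
have sq i : (X i - (v \in gsupp f i)%:R * q) * (X i - (v \in gsupp f i)%:R * q) =
    X i * X i + ((- 2 * q) * X i + q ^+ 2 * (v \in gsupp f i)%:R).
  case: (boolP (v \in gsupp f i)) => vi /=; first by ring.
  have -> : X i = 0.
    rewrite /X [X in X - _](grad_notin_gsupp b vi).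
    by rewrite [X in _ - X](grad_notin_gsupp x vi) subr0.
  by ring.
under eq_bigr do rewrite YE sq.
under [in leRHS]eq_bigr do rewrite XE.
rewrite !big_split/= -!mulr_sumr !mulrDr gerDl.
rewrite !(mulrCA n%:R^-1) EX -pfreqE -/p.
suff : 0 <= p * q ^+ 2 by nra.
by rewrite mulr_ge0 ?sqr_ge0// /p /pfreq mulr_ge0 ?invr_ge0 ?ler0n.
Qed.

(** * Second moment of the direction in terms of optimality gaps *)

Context (L : R) (xs : 'rV[R]_d).
Hypothesis L_gt0 : 0 < L.
Hypothesis cf : forall i, convex_function setT (f i).
Hypothesis lip : forall i, lipschitz_grad L (f i).
Hypothesis xs_min : forall x, favg f xs <= favg f x.

Lemma grad_favg_min : lgrad (favg f) xs = 0.
Proof. by rewrite -gradL; apply: grad_min => //; exact: differentiable_favg. Qed.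

(** Averaging cocoercivity at [xs] removes the linear terms, since the mean gradient vanishes
    there. *)
Lemma cocoercivity_favg a :
  n%:R^-1 * \sum_(i < n) sqn (lgrad (f i) a - lgrad (f i) xs) <=
  2 * L * (favg f a - favg f xs).
Proof.
have H : \sum_(i < n) dotp (lgrad (f i) xs) (a - xs) = 0.
  apply: (mulfI (invr_neq0 n_neq0)); rewrite mulr0 -dotp_suml -dotpZl -grad_favg.
  by rewrite grad_favg_min dotp0l.
rewrite /favg -mulrBr mulrCA ler_wpM2l ?invr_ge0 ?ler0n//.
have -> : \sum_(i < n) f i a - \sum_(i < n) f i xs =
    \sum_(i < n) (f i a - f i xs - dotp (lgrad (f i) xs) (a - xs)).
  by rewrite sumrB H subr0 sumrB.
rewrite mulr_sumr.
by apply: ler_sum => i _; rewrite -gradL; exact: cocoercivity.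
Qed.

(** Inserting the gradient at [xs] splits the direction into a part depending on [a] and a centred
    part depending on [b]; each is bounded by cocoercivity, the second after the variance bound. *)
Lemma svrg_dir_second_moment a b :
  n%:R^-1 * \sum_(i < n) sqn (svrg_dir f i a b) <=
  4 * L * ((favg f a - favg f xs) + (favg f b - favg f xs)).
Proof.
have Ha := cocoercivity_favg a; have Hb := cocoercivity_favg b.
have Hv := svrg_correction_variance b xs grad_favg_min.
have : n%:R^-1 * \sum_(i < n) sqn (svrg_dir f i a b) <=
    n%:R^-1 * \sum_(i < n) (2 * sqn (lgrad (f i) a - lgrad (f i) xs) +
     2 * sqn (lgrad (f i) b - lgrad (f i) xs - lgrad (favg f) b *m Dimx f i)).
  rewrite ler_wpM2l ?invr_ge0 ?ler0n//; apply: ler_sum => i _.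
  apply: le_trans (sqnB_le _ _); rewrite le_eqVlt; apply/orP; left; apply/eqP.
  congr sqn; rewrite /svrg_dir gradL.
  move: (lgrad _ a) (lgrad _ b) (lgrad _ xs) (_ *m _) => p q r s.
  by apply/rowP => v; rewrite !mxE; ring.
rewrite big_split/= -!mulr_sumr mulrDr !(mulrCA n%:R^-1) => H.
apply: (le_trans H).
have -> : 4 * L * (favg f a - favg f xs + (favg f b - favg f xs)) =
  2 * (2 * L * (favg f a - favg f xs)) + 2 * (2 * L * (favg f b - favg f xs)) by ring.
by apply: lerD; rewrite ler_pM2l//; exact: le_trans Hv Hb.
Qed.

End FiniteSum.

(** * Random variables with finitely many values *)

Section SimpleMaps.
Context {T : Type} {H : set (set T)}.
Hypothesis sH : sigma_algebra setT H.

(** Preimages of all sets are required to lie in [H], so [U] needs no sigma-algebra and composition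
    with an arbitrary function preserves the notion. Keeping [H] general covers both the events of
    [T] and the histories of a run. *)
Definition simple_map {U : Type} (X : T -> U) :=
  finite_set (range X) /\ forall A : set U, H (X @^-1` A).

Lemma sigma_algebraU A B : H A -> H B -> H (A `|` B).
Proof.
move=> HA HB; rewrite -bigcup2E; case: sH => H0 _; apply => -[|[|]] //=.
Qed.

Lemma sigma_algebraI A B : H A -> H B -> H (A `&` B).
Proof.
move=> HA HB; rewrite -[A `&` B]setCK setCI.
have HC C : H C -> H (~` C) by case: sH => _ HD _ /HD; rewrite setTD.
by apply/HC/sigma_algebraU; exact: HC.
Qed.

Lemma simple_map_points {U : choiceType} (X : T -> U) :
  finite_set (range X) -> (forall u, H (X @^-1` [set u])) -> simple_map X.
Proof.
move=> fX HX; split => // A.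
have [s sE] : exists s : seq U, range X `&` A = [set` s].
  by apply/finite_seqP; exact: sub_finite_set fX.
have -> : X @^-1` A = \bigcup_(u in [set` s]) (X @^-1` [set u]).
  rewrite -sE; apply/seteqP; split => [w Aw|w [u [_ Au]] /= ->//].
  by exists (X w) => //; split => //; exists w.
rewrite bigcup_seq; apply: (big_ind H); [by case: sH|exact: sigma_algebraU|].
by move=> u _; exact: HX.
Qed.

Lemma simple_cst {U : Type} (u : U) : simple_map (fun=> u).
Proof.
split; first exact: finite_image_cst.
move=> A; have [Au|nAu] := pselect (A u).
  have -> : (fun=> u) @^-1` A = setT :> set T by apply/seteqP; split.
  by case: sH => H0 HD _; rewrite -setC0 -setTD; exact: HD.
have -> : (fun=> u) @^-1` A = set0 :> set T by apply/seteqP; split.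
by case: sH.
Qed.

Lemma simple_comp {U V : Type} (g : U -> V) (X : T -> U) :
  simple_map X -> simple_map (fun w => g (X w)).
Proof.
move=> [fX HX]; split; last by move=> A; exact: (HX (g @^-1` A)).
by have := finite_image g fX; rewrite image_comp.
Qed.

(** The pair has finite range and its point preimages are intersections, so [g] may be any
    function. *)
Lemma simple_comp2 {U V : choiceType} {W : Type} (g : U -> V -> W)
    (X : T -> U) (Y : T -> V) :
  simple_map X -> simple_map Y -> simple_map (fun w => g (X w) (Y w)).
Proof.
move=> [fX HX] [fY HY].
have : simple_map (fun w => (X w, Y w)).
  apply: simple_map_points; first exact: (finite_image11 pair fX fY).
  move=> [u v]; have -> : (fun w => (X w, Y w)) @^-1` [set (u, v)] =
      (X @^-1` [set u]) `&` (Y @^-1` [set v]).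
    by apply/seteqP; split => w /= [-> ->].
  exact: sigma_algebraI.
exact: (simple_comp (fun p => g p.1 p.2)).
Qed.

Lemma simple_sum {I : Type} {V : nmodType} (r : seq I) (Q : pred I)
    (F : I -> T -> V) : (forall i, simple_map (F i)) ->
  simple_map (fun w => \sum_(i <- r | Q i) F i w).
Proof.
move=> sF; elim: r => [|i r IH].
  have -> : (fun w => \sum_(i <- [::] | Q i) F i w) = (fun=> 0).
    by apply/funext => w; rewrite big_nil.
  exact: simple_cst.
have -> : (fun w => \sum_(i <- i :: r | Q i) F i w) =
    (fun w => (if Q i then F i w else 0) + \sum_(i <- r | Q i) F i w).
  by apply/funext => w; rewrite big_cons; case: ifP; rewrite ?add0r.
apply: simple_comp2 => //; case: (Q i) => //; exact: simple_cst.
Qed.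

End SimpleMaps.
Arguments simple_map {T} H {U} X.

(** * Expectation and independence for simple variables *)

Section Expectation.
Context {R : realType} {disp : measure_display} {T : measurableType disp}.
Context (P : probability T R).
Implicit Types (X Y : T -> R) (c : R).

Local Notation simple := (simple_map (@measurable disp T)).
Let sM := sigma_algebra_measurable T.

Definition Ex X : R := fine ('E_P[X])%E.

Lemma simple_Lfun1 X : simple X -> X \in Lfun P 1.
Proof.
move=> [fX mX]; apply/Lfun1_integrable.
apply: measurable_bounded_integrable => //.
- by rewrite -ge0_fin_numE// fin_num_measure.
- by move=> _ A mA; rewrite setTI; exact: mX.
- have [s sE] : exists s : seq R, range X = [set` s] by apply/finite_seqP.
  (* The sum of the absolute values of all attained values is a crude uniform bound. *)
  exists (\sum_(c <- s) `|c|); split; first exact: num_real.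
  move=> M ltM w _ /=; apply: le_trans (ltW ltM).
  have : X w \in s by have : range X (X w) by [exists w]; rewrite sE.
  elim: s {sE ltM} => // c s IH; rewrite inE big_cons => /orP[/eqP->|/IH].
    by rewrite lerDl sumr_ge0.
  by move=> /le_trans; apply; rewrite lerDr.
Qed.

Lemma expectation_simple X : simple X -> ('E_P[X] = (Ex X)%:E)%E.
Proof. by move=> /simple_Lfun1 iX; rewrite fineK// expectation_fin_num. Qed.

Lemma ExD X Y : simple X -> simple Y ->
  Ex (fun w => X w + Y w) = Ex X + Ex Y.
Proof.
move=> sX sY; apply: EFin_inj; rewrite EFinD -!expectation_simple//.
  by rewrite -expectationD ?simple_Lfun1.
exact: (simple_comp2 sM).
Qed.

Lemma ExZ c X : simple X -> Ex (fun w => c * X w) = c * Ex X.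
Proof.
move=> sX; apply: EFin_inj; rewrite EFinM -!expectation_simple//.
  by rewrite -expectationZl ?simple_Lfun1//; congr expectation; apply/funext => w;
    rewrite /= mulrC.
exact: simple_comp.
Qed.

Lemma ExB X Y : simple X -> simple Y ->
  Ex (fun w => X w - Y w) = Ex X - Ex Y.
Proof.
move=> sX sY; have -> : (fun w => X w - Y w) = (fun w => X w + (-1) * Y w).
  by apply/funext => w; rewrite mulN1r.
by rewrite ExD// ?ExZ ?mulN1r//; exact: simple_comp.
Qed.

Lemma Ex_cst c : Ex (fun=> c) = c.
Proof. by rewrite /Ex -[fun=> c]/(cst c) expectation_cst. Qed.

Lemma Ex_ge0 X : (forall w, 0 <= X w) -> 0 <= Ex X.
Proof. by move=> X0; rewrite fine_ge0// expectation_ge0. Qed.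

Lemma Ex_le X Y : simple X -> simple Y -> (forall w, X w <= Y w) -> Ex X <= Ex Y.
Proof.
move=> sX sY XY; rewrite -subr_ge0 -ExB//; apply: Ex_ge0 => w.
by rewrite subr_ge0.
Qed.

Lemma Ex_sum I (r : seq I) (Q : pred I) (F : I -> T -> R) :
  (forall i, simple (F i)) ->
  Ex (fun w => \sum_(i <- r | Q i) F i w) = \sum_(i <- r | Q i) Ex (F i).
Proof.
move=> sF; elim: r => [|i r IH].
  rewrite big_nil -[RHS](Ex_cst 0); congr Ex.
  by apply/funext => w; rewrite big_nil.
rewrite big_cons -IH; case: ifP => Qi.
  rewrite -ExD//; last exact: (simple_sum sM).
  by congr Ex; apply/funext => w; rewrite big_cons Qi.
by congr Ex; apply/funext => w; rewrite big_cons Qi.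
Qed.

Lemma simple_indic (B : set T) : measurable B -> simple (\1_B : T -> R).
Proof.
move=> mB; apply: (simple_map_points sM).
  by apply: (@sub_finite_set _ _ [set 0; 1]) => // _ [w _ <-]; rewrite /indic;
    case: (w \in B) => /=; [right|left].
by move=> c; rewrite -[X in measurable X]setTI;
  exact: measurable_realfun.measurable_indic.
Qed.

(** [Y] is expanded over its finitely many values, which reduces the factorization to the events
    [Y = c]. *)
Lemma Ex_indep (Y : T -> R) (B : set T) p : simple Y -> measurable B ->
  (forall c, P (Y @^-1` [set c] `&` B) = (P (Y @^-1` [set c]) * p%:E)%E) ->
  Ex (fun w => Y w * \1_B w) = Ex Y * p.
Proof.
move=> sY mB indep; have [fY mY] := sY.
have [s sE] : exists s : seq R, range Y = [set` s] by apply/finite_seqP.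
(* Each value must be counted once for the expansion to hold. *)
pose r := undup s.
have YE w : Y w = \sum_(c <- r) c * \1_(Y @^-1` [set c]) w.
  have Yr : Y w \in r.
    by rewrite mem_undup; have : range Y (Y w) by [exists w]; rewrite sE.
  rewrite (bigD1_seq (Y w)) ?undup_uniq//= big1 ?addr0; last first.
    move=> c cY; rewrite indicE memNset ?mulr0// => /= E.
    by rewrite -E eqxx in cY.
  by rewrite indicE mem_set// mulr1.
have EP (A : set T) : measurable A -> Ex \1_A = fine (P A).
  by move=> mA; rewrite /Ex expectation_indic.
have -> : Y = fun w => \sum_(c <- r) c * \1_(Y @^-1` [set c]) w.
  by apply/funext.
have sc c : simple (fun w => c * \1_(Y @^-1` [set c]) w).
  by apply: (simple_comp ( *%R c)); apply: simple_indic.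
rewrite Ex_sum//.
have -> : (fun w => (\sum_(c <- r) c * \1_(Y @^-1` [set c]) w) * \1_B w) =
   fun w => \sum_(c <- r) c * \1_(Y @^-1` [set c] `&` B) w.
  apply/funext => w; rewrite mulr_suml; apply: eq_bigr => c _.
  by rewrite indicI mulrA.
rewrite Ex_sum; last first.
  move=> c; apply: (simple_comp ( *%R c)); apply: simple_indic.
  exact: measurableI.
rewrite mulr_suml; apply: eq_bigr => c _.
rewrite !ExZ; [|exact: simple_indic|by apply/simple_indic/measurableI].
rewrite !EP//; last exact: measurableI.
by rewrite indep fineM ?fin_num_measure// mulrA.
Qed.

(** Splitting over the value of [X] replaces conditional expectation given [H]. It serves both the
    sampled indices and the choice of the next snapshot. *)
Lemma Ex_uniform (H : set (set T)) N (X : T -> 'I_N) (Y : 'I_N -> T -> R) :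
  H `<=` measurable -> (forall i, measurable [set w | X w = i]) ->
  uniform_indep P X H -> (forall i, simple_map H (Y i)) ->
  Ex (fun w => Y (X w) w) = Ex (fun w => N%:R^-1 * \sum_(i < N) Y i w).
Proof.
move=> HM mX [uX indep] sY.
have sY' i : simple (Y i) by have [? ?] := sY i; split => // A; exact: HM.
pose B i := [set w | X w = i].
have -> : (fun w => Y (X w) w) = fun w => \sum_(i < N) Y i w * \1_(B i) w.
  apply/funext => w; rewrite (bigD1 (X w))//= big1 ?addr0; last first.
    by move=> i iX; rewrite indicE memNset ?mulr0// /B/= => E; rewrite E eqxx in iX.
  by rewrite indicE mem_set// mulr1.
rewrite Ex_sum; last first.
  by move=> i; apply: (simple_comp2 sM *%R) => //; exact/simple_indic/mX.
rewrite ExZ; last exact: (simple_sum sM).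
rewrite Ex_sum// mulr_sumr; apply: eq_bigr => i _; rewrite mulrC.
apply: (Ex_indep _ _ _ (sY' i) (mX i)).
by move=> c; rewrite indep ?uX//; have [_] := sY i; exact.
Qed.

End Expectation.

(** * Executions *)

Section Run.
Context {R : realType} {disp : measure_display} {T : measurableType disp}.
Context {d n m tau : nat} (f : 'I_n -> 'rV[R]_d -> R) (gamma : R).
Context (x0 : 'rV[R]_d) (K : @run R disp T d n m).
Hypothesis m_gt0 : (0 < m)%N.
Hypothesis exK : execution f gamma K x0.

Local Notation dir := (direction f K).

Lemma epoch_index k j : (j < m)%N -> ((k * m + j) %/ m = k)%N.
Proof. by move=> jm; rewrite divnMDl// divn_small// addn0. Qed.

(* Reads are ordered by label, so a write is seen only by later labels. *)
Lemma write_after_read t u v w : (t <= u)%N -> v \in gsupp f (idx K u w) ->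
  (write_at K u v w < read_at K t v w) = false.
Proof.
move=> tu vS; apply/negbTE; rewrite -leNgt.
have /andP[_ h1] := exec_read_time exK t v w.
have /andP[h2 _] := exec_write_time exK vS.
by apply: le_trans h1 (le_trans _ h2); exact: (exec_label exK).
Qed.

Lemma write_before_read t u v w : bounded_overlap tau K ->
  (u + tau < t)%N -> v \in gsupp f (idx K u w) ->
  write_at K u v w < read_at K t v w.
Proof.
move=> bo ut vS; have ut' : (u + tau + 1 <= t)%N by rewrite addn1.
have /andP[h1 h2] := exec_read_time exK t v w.
have /andP[h3 h4] := exec_write_time exK vS.
have hl : read_end K u w <= read_end K t w by apply: (exec_label exK); lia.
have /andP[a1 a2] := exec_time exK u w; have /andP[b1 b2] := exec_time exK t w.
have : write_end K u w < read_start K t w.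
  rewrite ltNge; apply/negP => le.
  (* If [t] started before [u] finished, both would be in process at the later of their two start
     times. *)
  have nb := bo u t w ut'; case: nb.
  have [c|c] := leP (read_start K u w) (read_start K t w).
    by exists (read_start K t w); split; apply/andP; split => //; lra.
  by exists (read_start K u w); split; apply/andP; split => //; lra.
lra.
Qed.

(** The memory sums over the whole epoch, but labels from [j] on are invisible to read [j]. What is
    left is a recursion on [j]. *)
Lemma xhatE k j v w : (j < m)%N -> xhat K (k * m + j) w 0 v =
  xtilde K k w 0 v - \sum_(i < j | (v \in gsupp f (idx K (k * m + i) w)) &&
    (write_at K (k * m + i) v w < read_at K (k * m + j) v w))
       gamma * dir (k * m + i) w 0 v.
Proof.
move=> jm; rewrite (exec_read exK) /memory epoch_index//; congr (_ - _).
rewrite -[X in \sum_(X <= _ < _ | _) _]add0n mulSn big_addn addnK.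
rewrite -(big_mkord (fun i => (v \in gsupp f (idx K (k * m + i) w)) &&
    (write_at K (k * m + i) v w < read_at K (k * m + j) v w))
    (fun i => gamma * dir (k * m + i) w 0 v)).
rewrite (big_cat_nat (leq0n j) (ltnW jm))/= [X in _ + X]big1_seq ?addr0.
  by apply: eq_big => i; rewrite addnC.
move=> i; rewrite mem_index_iota addnC => /andP[/andP[vS W] /andP[ji _]].
by rewrite write_after_read// leq_add2l in W.
Qed.

Definition virtual k j w : 'rV[R]_d :=
  xtilde K k w - gamma *: \sum_(i < j) dir (k * m + i) w.

Lemma direction_notin_gsupp t v w : v \notin gsupp f (idx K t w) ->
  dir t w 0 v = 0.
Proof. exact: svrg_dir_notin_gsupp. Qed.

(** The difference consists of the updates with label below [j] that the read missed. An update more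
    than [tau] labels old is either seen or zero at [v]. *)
Lemma xhat_virtual_le k j v w : 0 <= gamma -> bounded_overlap tau K ->
  (j < m)%N ->
  `|xhat K (k * m + j) w 0 v - virtual k j w 0 v| <=
    gamma * \sum_(i < j | (j <= i + tau)%N) `|dir (k * m + i) w 0 v|.
Proof.
move=> g0 bo jm; rewrite xhatE// /virtual !mxE summxE.
set S1 := \sum_(i < j | _) _; set S2 := \sum_(i < j) _.
have -> : xtilde K k w 0 v - S1 - (xtilde K k w 0 v - gamma * S2) =
  gamma * S2 - S1 by ring.
rewrite /S1 /S2 mulr_sumr (bigID (fun i : 'I_j =>
  (v \in gsupp f (idx K (k * m + i) w)) &&
    (write_at K (k * m + i) v w < read_at K (k * m + j) v w)))/= addrAC subrr add0r.
apply: le_trans (ler_norm_sum _ _ _) _.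
rewrite mulr_sumr [leRHS]big_mkcond/= big_mkcond/=; apply: ler_sum => i _.
rewrite normrM (ger0_norm g0).
have nn : 0 <= gamma * `|dir (k * m + i) w 0 v| by rewrite mulr_ge0.
case: ifP => H1; case: ifP => H2 //.
have [vS|vS] := boolP (v \in gsupp f (idx K (k * m + i) w)).
  move: H1; rewrite vS/= write_before_read//.
  by rewrite -addnA ltn_add2l ltnNge H2.
by rewrite direction_notin_gsupp// normr0 mulr0.
Qed.

Lemma direction_simple H t : sigma_algebra setT H ->
  simple_map H (idx K t) -> simple_map H (xhat K t) ->
  simple_map H (xtilde K (t %/ m)) -> simple_map H (dir t).
Proof.
move=> sH si sx sxt.
have sp := simple_comp2 sH pair _ _ si sx.
exact: (simple_comp2 sH (fun p b => svrg_dir f p.1 p.2 b) _ _ sp sxt).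
Qed.

(** A row vector is rebuilt from its coordinates, so only coordinate events have to lie in [H]. *)
Lemma simple_row H (X : T -> 'rV[R]_d) : sigma_algebra setT H ->
  finite_set (range X) -> (forall v c, H [set w | X w 0 v = c]) ->
  simple_map H X.
Proof.
move=> sH fX HX.
have -> : X = fun w => \sum_(v < d) X w 0 v *: delta_mx 0 v.
  by apply/funext => w; rewrite -row_sum_delta.
apply: simple_sum => // v; apply: (simple_comp (fun c => c *: delta_mx 0 v)).
apply: simple_map_points => //; last by move=> c; exact: HX.
by have := finite_image (fun x : 'rV[R]_d => x 0 v) fX; rewrite image_comp.
Qed.

Lemma xtilde_next_simple H k : sigma_algebra setT H ->
  simple_map H (chosen K k) ->
  (forall j, (j < m)%N -> simple_map H (xhat K (k * m + j))) ->
  simple_map H (xtilde K k.+1).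
Proof.
move=> sH sc sx.
have -> : xtilde K k.+1 =
    fun w => \sum_(j < m) (chosen K k w == j)%:R *: xhat K (k * m + j) w.
  apply/funext => w; rewrite (exec_epoch exK) (bigD1 (chosen K k w))//= eqxx scale1r.
  rewrite big1 ?addr0// => j; rewrite eq_sym => /negbTE ->; exact: scale0r.
apply: simple_sum => // j.
by apply: (simple_comp2 sH (fun (c : 'I_m) x => (c == j)%:R *: x)) => //; exact: sx.
Qed.

Lemma finite_range_run k : finite_set (range (xtilde K k)) /\
  forall j, (j < m)%N -> finite_set (range (xhat K (k * m + j))).
Proof.
have sT : sigma_algebra setT (@setT (set T)) by split.
pose fin U (X : T -> U) := simple_map (@setT (set T)) X.
have finP U (X : T -> U) : finite_set (range X) -> fin U X by split.
suff H : fin _ (xtilde K k) /\ forall j, (j < m)%N -> fin _ (xhat K (k * m + j)).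
  by case: H => -[? _] H; split => // j /H[].
have xh i : fin _ (xtilde K i) -> forall j, (j < m)%N -> fin _ (xhat K (i * m + j)).
  move=> fxt; elim/ltn_ind => j IH jm.
  have -> : xhat K (i * m + j) =
      fun w => \sum_(v < d) xhat K (i * m + j) w 0 v *: delta_mx 0 v.
    by apply/funext => w; rewrite -row_sum_delta.
  apply: simple_sum => // v; apply: (simple_comp (fun c => c *: delta_mx 0 v)).
  under eq_fun do rewrite xhatE//.
  apply: (simple_comp2 sT (fun a b => a - b)).
    exact: (simple_comp (fun x : 'rV[R]_d => x 0 v)).
  under eq_fun do rewrite big_mkcond/=.
  apply: simple_sum => // l.
  (* The visibility of a write depends on time stamps of unknown measurability, but it takes only
     two values. *)
  pose B w := (v \in gsupp f (idx K (i * m + l) w)) &&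
    (write_at K (i * m + l) v w < read_at K (i * m + j) v w).
  apply: (simple_comp2 sT (fun (b : bool) (x : 'rV[R]_d) =>
    if b then gamma * x 0 v else 0) B).
    by apply: finP; exact: finite_finset.
  have lm : (l < m)%N by apply: ltn_trans jm.
  have si : fin _ (idx K (i * m + l)) by apply: finP; exact: finite_finset.
  apply: (direction_simple _ _ sT si (IH l (ltn_ord l) lm)).
  by rewrite epoch_index.
have xt : fin _ (xtilde K k).
  elim: k => [|k IH].
    have -> : xtilde K 0 = fun=> x0 by apply/funext => w; exact: (exec_init exK).
    exact: simple_cst.
  have sc : fin _ (chosen K k) by apply: finP; exact: finite_finset.
  exact: (xtilde_next_simple _ _ sT sc (xh k IH)).
by split => //; exact: xh.
Qed.

Lemma finite_range_xhat t : finite_set (range (xhat K t)).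
Proof.
by rewrite (divn_eq t m); apply: (finite_range_run _).2; rewrite ltn_mod.
Qed.

(** * Measurability of the run and of its histories *)

Context (P : probability T R).
Hypothesis rrK : random_run P K.

Local Notation simple := (simple_map (@measurable disp T)).
Let sM := sigma_algebra_measurable T.

Lemma xhat_simple t : simple (xhat K t).
Proof.
apply: simple_row => //; first exact: finite_range_xhat.
move=> v c; have := rr_xhat rrK t v measurableT (measurable_set1 c).
by rewrite setTI.
Qed.

Lemma idx_simple t : simple (idx K t).
Proof.
by apply: simple_map_points => //; [exact: finite_finset|exact: rr_idx rrK t].
Qed.

Lemma chosen_simple k : simple (chosen K k).
Proof.
by apply: simple_map_points => //; [exact: finite_finset|exact: rr_chosen rrK k].
Qed.

Lemma xtilde_simple k : simple (xtilde K k).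
Proof.
case: k => [|k].
  have -> : xtilde K 0 = fun=> x0 by apply/funext => w; exact: (exec_init exK).
  exact: simple_cst.
apply: xtilde_next_simple => //; first exact: chosen_simple.
by move=> j _; exact: xhat_simple.
Qed.

Lemma dir_simple t : simple (dir t).
Proof.
by apply: direction_simple => //;
  [exact: idx_simple|exact: xhat_simple|exact: xtilde_simple].
Qed.

Lemma history_measurable a b c : history K a b c `<=` measurable.
Proof.
apply: smallest_sub => // A [[u [v [B [_ _ ->]]]]|[[u [i [_ ->]]]|[j [v [B [_ _ ->]]]]]].
- exact: ((xhat_simple u).2 [set x | B (x 0 v)]).
- exact: ((idx_simple u).2 [set i]).
- exact: ((xtilde_simple j).2 [set x | B (x 0 v)]).
Qed.

Lemma history_sigma a b c : sigma_algebra setT (history K a b c).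
Proof. exact: smallest_sigma_algebra. Qed.

Lemma history_xhat a b c u : (u < a)%N -> simple_map (history K a b c) (xhat K u).
Proof.
move=> ua; apply: simple_row; [exact: history_sigma|exact: finite_range_xhat|].
move=> v x; apply: sub_sigma_algebra; left.
by exists u, v, [set x]; split => //; exact: measurable_set1.
Qed.

Lemma history_xtilde a b c k : (k < c)%N ->
  simple_map (history K a b c) (xtilde K k).
Proof.
move=> kc; apply: simple_row; [exact: history_sigma|exact: (finite_range_run _).1|].
move=> v x; apply: sub_sigma_algebra; right; right.
by exists k, v, [set x]; split => //; exact: measurable_set1.
Qed.

Lemma history_idx a b c u : (u < b)%N -> simple_map (history K a b c) (idx K u).
Proof.
move=> ub; apply: simple_map_points; [exact: history_sigma|exact: finite_finset|].
by move=> i; apply: sub_sigma_algebra; right; left; exists u, i.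
Qed.

Lemma history_direction a b c u : (u < a)%N -> (u < b)%N -> (u %/ m < c)%N ->
  simple_map (history K a b c) (dir u).
Proof.
move=> ua ub uc; apply: direction_simple; first exact: history_sigma.
- exact: history_idx.
- exact: history_xhat.
- exact: history_xtilde.
Qed.

(** * Expected progress, energy and delay in one step *)

Context (L mu : R) (xs : 'rV[R]_d).
Hypothesis n_gt0 : (0 < n)%N.
Hypothesis gamma_ge0 : 0 <= gamma.
Hypothesis L_gt0 : 0 < L.
Hypothesis mu_gt0 : 0 < mu.
Hypothesis convex_f : forall i, convex_function setT (f i).
Hypothesis diff_f : forall i x, differentiable (f i) x.
Hypothesis lip_f : forall i, lipschitz_grad L (f i).
Hypothesis sc_f : strongly_convex mu (favg f).
Hypothesis xs_min : forall x, favg f xs <= favg f x.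
Hypothesis overlapK : bounded_overlap tau K.

Local Notation E := (Ex P).
Local Notation gap X := (E (fun w => favg f (X w)) - favg f xs).
Local Notation energy t := (E (fun w => sqn (dir t w))).
Local Notation s := (Num.sqrt (sparsity f : R)).

Lemma gapE X : simple X -> gap X = E (fun w => favg f (X w) - favg f xs).
Proof.
move=> sX; rewrite ExB ?Ex_cst//; last exact: simple_cst.
exact: (simple_comp (favg f)).
Qed.

Lemma gap_simple X : simple X -> simple (fun w => favg f (X w) - favg f xs).
Proof. by move=> sX; exact: (simple_comp (fun x => favg f x - favg f xs)). Qed.

Lemma gap_ge0 X : simple X -> 0 <= gap X.
Proof. by move=> sX; rewrite gapE//; apply: Ex_ge0 => w; rewrite subr_ge0. Qed.

Lemma energy_ge0 t : 0 <= energy t.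
Proof. by apply: Ex_ge0 => w; exact: sqn_ge0. Qed.

Lemma sqn_dir_simple t : simple (fun w => sqn (dir t w)).
Proof. exact/simple_comp/dir_simple. Qed.

(** This history contains read [t] and the current snapshot but only the indices before [t], so
    [idx K t] can be averaged out with everything else frozen. *)
Lemma Ex_sample t (Y : 'I_n -> T -> R) :
  (forall i, simple_map (history K t.+1 t (t %/ m).+1) (Y i)) ->
  E (fun w => Y (idx K t w) w) = E (fun w => n%:R^-1 * \sum_(i < n) Y i w).
Proof.
move=> sY; apply: Ex_uniform sY; [exact: history_measurable|exact: rr_idx rrK t|].
exact: rr_sample.
Qed.

Lemma history_svrg_dir {V : Type} t (phi : 'rV[R]_d -> 'rV[R]_d -> V) :
  simple_map (history K t.+1 t (t %/ m).+1)
    (fun w => phi (xhat K t w) (xtilde K (t %/ m) w)).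
Proof.
apply: (simple_comp2 (history_sigma _ _ _) phi).
  exact: history_xhat.
exact: history_xtilde.
Qed.

Lemma energy_le t :
  energy t <= 4 * L * (gap (xhat K t) + gap (xtilde K (t %/ m))).
Proof.
have sx := xhat_simple t; have st := xtilde_simple (t %/ m).
have -> : energy t = E (fun w =>
    n%:R^-1 * \sum_(i < n) sqn (svrg_dir f i (xhat K t w) (xtilde K (t %/ m) w))).
  rewrite -(Ex_sample t (fun i w =>
    sqn (svrg_dir f i (xhat K t w) (xtilde K (t %/ m) w))))//.
  by move=> i; exact: (history_svrg_dir _ (fun a b => sqn (svrg_dir f i a b))).
rewrite !gapE// -(ExD P _ _ (gap_simple _ sx) (gap_simple _ st)).
rewrite -(ExZ P (4 * L)); last first.
  exact: (simple_comp2 sM (fun a b => a + b) _ _ (gap_simple _ sx) (gap_simple _ st)).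
apply: Ex_le => [||w]; last exact: svrg_dir_second_moment.
  exact: (simple_comp2 sM (fun a b =>
    n%:R^-1 * \sum_(i < n) sqn (svrg_dir f i a b)) _ _ sx st).
exact: (simple_comp2 sM (fun a b =>
  4 * L * (favg f a - favg f xs + (favg f b - favg f xs))) _ _ sx st).
Qed.

(** After averaging over the index, the direction becomes the gradient of [favg f] at the read
    vector, and the first-order inequality towards [xs] applies. *)
Lemma gap_le_progress t :
  gap (xhat K t) <= E (fun w => dotp (dir t w) (xhat K t w - xs)).
Proof.
have sx := xhat_simple t; have st := xtilde_simple (t %/ m).
pose Y i w := dotp (svrg_dir f i (xhat K t w) (xtilde K (t %/ m) w)) (xhat K t w - xs).
have -> : E (fun w => dotp (dir t w) (xhat K t w - xs)) =
    E (fun w => n%:R^-1 * \sum_(i < n) Y i w).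
  rewrite -(Ex_sample t Y)// => i.
  by exact: (history_svrg_dir _ (fun a b => dotp (svrg_dir f i a b) (a - xs))).
rewrite gapE//; apply: Ex_le => [||w]; first exact: gap_simple.
  exact: (simple_comp2 sM (fun a b =>
    n%:R^-1 * \sum_(i < n) dotp (svrg_dir f i a b) (a - xs)) _ _ sx st).
rewrite /Y -dotp_suml -dotpZl svrg_dir_mean//.
have := strongly_convex_first_order mu (favg f) (xhat K t w) xs
  (differentiable_favg f diff_f) sc_f.
rewrite gradL -opprB sqnN dotpNr; have := sqn_ge0 (xhat K t w - xs).
move: (sqn _) (dotp _ _) => q p q0 H.
have : 0 <= mu / 2 * q by rewrite mulr_ge0// divr_ge0// ltW.
by lra.
Qed.

(** AM-GM in which [b] says whether the coordinate is in the support of [y]; the indicator lands on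
    [x ^+ 2], where sparsity is gained. Positivity of [c] is asked only under [b], as [c] will be
    the root of the sparsity constant. *)
Lemma mulr_norm_amgm (c x y : R) (b : bool) :
  (b -> 0 < c) -> (~~ b -> y = 0) ->
  `|x| * `|y| <= 2^-1 * (c^-1 * (b%:R * x ^+ 2) + c * (y * y)).
Proof.
case: b => [/(_ isT) c0 _|_ /(_ isT) ->]; last first.
  by rewrite normr0 !mulr0 mul0r !mulr0 addr0 mulr0.
rewrite mul1r -expr2 -[X in c^-1 * X]real_normK ?num_real//.
rewrite -[X in c * X]real_normK ?num_real//.
move: (`|x|) (`|y|) => {x y} x y.
have : 0 <= c^-1 * (x - c * y) ^+ 2 by rewrite mulr_ge0 ?sqr_ge0// invr_ge0 ltW.
have -> : c^-1 * (x - c * y) ^+ 2 = c^-1 * x ^+ 2 - 2 * (x * y) + c * y ^+ 2.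
  by field; rewrite gt_eqF.
by move: (c^-1 * _) (x * y) (c * _) => p q r; lra.
Qed.

(** Since [idx K t] is independent of the earlier direction, a coordinate of [dir u] survives the
    restriction to the later support with probability [pfreq f v], at most the sparsity constant.
    The AM-GM weight [s] balances the two energies. *)
Lemma sparse_dotp_le t u : (u < t)%N -> (u %/ m <= t %/ m)%N ->
  E (fun w => \sum_(v < d) `|dir u w 0 v| * `|dir t w 0 v|) <=
    s / 2 * (energy u + energy t).
Proof.
move=> ut utm; have su := dir_simple u; have st := dir_simple t.
have s2 : s * s = sparsity f by rewrite -expr2 sqr_sqrtr// sparsity_ge0.
(* This also holds for [s = 0], where the inverse is 0 by convention. *)
have sVD : s^-1 * sparsity f = s.
  rewrite -{2}s2; have [->|s0] := eqVneq s 0; first by rewrite !mulr0.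
  by rewrite mulKf.
pose Y i w : R := \sum_(v < d) (v \in gsupp f i)%:R * dir u w 0 v ^+ 2.
have EY : E (fun w => Y (idx K t w) w) <= sparsity f * energy u.
  rewrite (Ex_sample t Y); last first.
    move=> i; apply: (simple_comp (fun x : 'rV[R]_d =>
      \sum_(v < d) (v \in gsupp f i)%:R * x 0 v ^+ 2)).
    by apply: history_direction; rewrite ?ltnS// ltnW.
  rewrite -(ExZ P (sparsity f)); last exact: sqn_dir_simple.
  apply: Ex_le => [||w].
  - exact: (simple_comp (fun x : 'rV[R]_d => n%:R^-1 *
      \sum_(i < n) \sum_(v < d) (v \in gsupp f i)%:R * x 0 v ^+ 2) _ su).
  - exact: (simple_comp (fun x => sparsity f * sqn x) _ su).
  rewrite /Y exchange_big/= [leLHS]mulr_sumr [leRHS]mulr_sumr.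
  apply: ler_sum => v _.
  rewrite -mulr_suml [leLHS]mulrA -pfreqE expr2 ler_wpM2r -?expr2 ?sqr_ge0//.
  exact: pfreq_le_sparsity.
have sY : simple (fun w => Y (idx K t w) w).
  exact: (simple_comp2 sM (fun i (x : 'rV[R]_d) =>
    \sum_(v < d) (v \in gsupp f i)%:R * x 0 v ^+ 2) _ _ (idx_simple t) su).
have sYc : simple (fun w => s^-1 * Y (idx K t w) w) by exact: (simple_comp ( *%R s^-1)).
have sgc : simple (fun w => s * sqn (dir t w)).
  exact: (simple_comp (fun x => s * sqn x) _ st).
apply: (@le_trans _ _ (E (fun w => 2^-1 * (s^-1 * Y (idx K t w) w + s * sqn (dir t w))))).
  apply: Ex_le => [||w].
  - exact: (simple_comp2 sM (fun x y : 'rV[R]_d =>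
      \sum_(v < d) `|x 0 v| * `|y 0 v|) _ _ su st).
  - by apply: (simple_comp ( *%R 2^-1)); exact: (simple_comp2 sM +%R).
  rewrite /Y /sqn /dotp !mulr_sumr -big_split/= mulr_sumr; apply: ler_sum => v _.
  apply: mulr_norm_amgm => vS.
    by rewrite sqrtr_gt0; apply: lt_le_trans (pfreq_le_sparsity f v); exact: pfreq_gt0 vS.
  exact: direction_notin_gsupp.
rewrite ExZ; last exact: (simple_comp2 sM +%R).
rewrite ExD// !ExZ//; last exact: sqn_dir_simple.
have : s^-1 * E (fun w => Y (idx K t w) w) <= s * energy u.
  by rewrite -{2}sVD -mulrA ler_wpM2l ?invr_ge0 ?sqrtr_ge0.
generalize (E (fun w => Y (idx K t w) w)) (energy u) (energy t) s => e gu gt c.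
by move: (c^-1 * e) => q H; lra.
Qed.

(** The step starts at [a] while [g] is computed at [x]; writing [a - z] as [(x - z) - (x - a)]
    separates progress from delay. *)
Lemma sqn_step (c : R) (a x z g : 'rV[R]_d) :
  sqn (a - c *: g - z) =
  sqn (a - z) - 2 * c * dotp g (x - z) + 2 * c * dotp g (x - a) + c ^+ 2 * sqn g.
Proof.
have -> : a - c *: g - z = (a - z) - c *: g by rewrite addrAC.
rewrite (sqnB (a - z)) sqnZ dotpZr [dotp (a - z) g]dotpC.
have -> : a - z = (x - z) - (x - a) by apply/rowP => v; rewrite !mxE; ring.
by rewrite [dotp g (_ - _ - _)]dotpBr; ring.
Qed.

Lemma mulr_sum_swap (I : Type) (r : seq I) (Q : pred I) (F : I -> R) (c y : R) :
  y * (c * \sum_(i <- r | Q i) F i) = c * \sum_(i <- r | Q i) (F i * y).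
Proof. by rewrite mulrCA [y * _]mulrC -mulr_suml. Qed.

Lemma dotp_le_normr (g y : 'rV[R]_d) (b : 'I_d -> R) :
  (forall v, `|y 0 v| <= b v) -> dotp g y <= \sum_(v < d) `|g 0 v| * b v.
Proof.
move=> yb; apply: ler_sum => v _; apply: le_trans (ler_norm _) _.
by rewrite normrM ler_wpM2l.
Qed.

Local Notation cross u t := (fun w => \sum_(v < d) `|dir u w 0 v| * `|dir t w 0 v|).
Local Notation dist k j := (E (fun w => sqn (virtual k j w - xs))).

Lemma cross_simple u t : simple (cross u t).
Proof.
exact: (simple_comp2 sM (fun x y : 'rV[R]_d => \sum_(v < d) `|x 0 v| * `|y 0 v|)
  _ _ (dir_simple u) (dir_simple t)).
Qed.

Lemma virtual_simple k j : simple (virtual k j).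
Proof.
have sS : simple (fun w => \sum_(i < j) dir (k * m + i) w).
  by apply: simple_sum => // i; exact: dir_simple.
exact: (simple_comp2 sM (fun a b => a - gamma *: b) _ _ (xtilde_simple k) sS).
Qed.

Lemma virtual_step_pointwise k j w : (j < m)%N ->
  sqn (virtual k j.+1 w - xs) <= sqn (virtual k j w - xs)
    + (- 2 * gamma) * dotp (dir (k * m + j) w) (xhat K (k * m + j) w - xs)
    + 2 * gamma ^+ 2 * \sum_(i < j | (j <= i + tau)%N) cross (k * m + i) (k * m + j) w
    + gamma ^+ 2 * sqn (dir (k * m + j) w).
Proof.
move=> jm; set g := dir (k * m + j) w; set x := xhat K (k * m + j) w.
have -> : virtual k j.+1 w = virtual k j w - gamma *: g.
  by rewrite /virtual big_ord_recr/= scalerDr opprD addrA.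
rewrite (sqn_step gamma _ x).
have : dotp g (x - virtual k j w) <=
    gamma * \sum_(i < j | (j <= i + tau)%N) cross (k * m + i) (k * m + j) w.
  apply: (@le_trans _ _ (\sum_(v < d) `|g 0 v| *
      (gamma * \sum_(i < j | (j <= i + tau)%N) `|dir (k * m + i) w 0 v|))).
    apply: dotp_le_normr => v; rewrite !mxE.
    by have := xhat_virtual_le k j v w gamma_ge0 overlapK jm; rewrite !mxE.
  rewrite exchange_big/= mulr_sumr; apply: ler_sum => v _.
  by rewrite [leLHS]mulr_sum_swap.
cbv beta; generalize (\sum_(i < j | (j <= i + tau)%N)
  \sum_(v < d) `|dir (k * m + i) w 0 v| * `|dir (k * m + j) w 0 v|) => q.
move: (dotp g (x - virtual k j w)) (dotp g (x - xs)) (sqn g) (sqn _) => p r G D H.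
have := ler_wpM2l gamma_ge0 H.
by rewrite mulrA -expr2; lra.
Qed.

(** Taking expectations, the delay coefficient [2 * gamma ^+ 2] meets the factor [s / 2] of each
    cross term. *)
Lemma virtual_step k j : (j < m)%N ->
  dist k j.+1 <= dist k j - 2 * gamma * gap (xhat K (k * m + j))
    + gamma ^+ 2 * (energy (k * m + j) + s * \sum_(i < j | (j <= i + tau)%N)
        (energy (k * m + i) + energy (k * m + j))).
Proof.
move=> jm; set t := (k * m + j)%N.
have s1 : simple (fun w => sqn (virtual k j w - xs)).
  exact: (simple_comp (fun x => sqn (x - xs)) _ (virtual_simple k j)).
have s1' : simple (fun w => sqn (virtual k j.+1 w - xs)).
  exact: (simple_comp (fun x => sqn (x - xs)) _ (virtual_simple k j.+1)).
pose B w := dotp (dir t w) (xhat K t w - xs).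
have sB : simple B.
  exact: (simple_comp2 sM (fun g x => dotp g (x - xs))
    _ _ (dir_simple t) (xhat_simple t)).
pose C w := \sum_(i < j | (j <= i + tau)%N) cross (k * m + i) t w.
have sC : simple C by apply: simple_sum => // i; exact: cross_simple.
have sG := sqn_dir_simple t.
have sZ c (X : T -> R) : simple X -> simple (fun w => c * X w).
  by move=> sX; exact: (simple_comp ( *%R c)).
have sD (X Y : T -> R) : simple X -> simple Y -> simple (fun w => X w + Y w).
  by move=> sX sY; exact: (simple_comp2 sM +%R).
have EC : E C <= s / 2 * \sum_(i < j | (j <= i + tau)%N)
    (energy (k * m + i) + energy t).
  rewrite /C Ex_sum; last by move=> i; exact: cross_simple.
  rewrite mulr_sumr; apply: ler_sum => i _; apply: sparse_dotp_le.
    by rewrite /t ltn_add2l.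
  by apply: leq_div2r; rewrite /t leq_add2l ltnW.
have EB := gap_le_progress t.
have : dist k j.+1 <= E (fun w => sqn (virtual k j w - xs)
    + (- 2 * gamma) * B w + 2 * gamma ^+ 2 * C w
    + gamma ^+ 2 * sqn (dir t w)).
  apply: Ex_le => // [|w]; last exact: virtual_step_pointwise.
  apply: (sD _ _ _ (sZ _ _ sG)); apply: (sD _ _ _ (sZ _ _ sC)).
  exact: (sD _ _ s1 (sZ _ _ sB)).
rewrite (ExD P _ _ _ (sZ _ _ sG)); last first.
  by apply: (sD _ _ _ (sZ _ _ sC)); exact: (sD _ _ s1 (sZ _ _ sB)).
rewrite (ExD P _ _ _ (sZ _ _ sC)); last exact: (sD _ _ s1 (sZ _ _ sB)).
rewrite (ExD P _ _ s1 (sZ _ _ sB)) (ExZ P _ _ sB) (ExZ P _ _ sC) (ExZ P _ _ sG).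
move=> /le_trans; apply.
pose S := \sum_(i < j | (j <= i + tau)%N) (energy (k * m + i) + energy t).
pose D := dist k j; pose e := energy t; pose g := gap (xhat K t).
change (D + -2 * gamma * E B + 2 * gamma ^+ 2 * E C + gamma ^+ 2 * e <=
  D - 2 * gamma * g + gamma ^+ 2 * (e + s * S)).
have gb : g <= E B by exact: EB.
have cS : E C <= s / 2 * S by exact: EC.
move: gb cS; generalize (E B) (E C) g e D S s => b c {}g {}e {}D {}S r gb cS.
have := ler_wpM2l gamma_ge0 gb; have := ler_wpM2l (sqr_ge0 gamma) cS.
move: (gamma ^+ 2) => h.
have -> : h * (r / 2 * S) = (h * (r * S)) / 2 by field.
rewrite (mulrDr h) -!(mulrA 2) !mulNr -(mulrA 2 gamma b).
by move: (h * (r * S)) (h * c) (h * e) (gamma * g) (gamma * b) => p1 p2 p3 p4 p5; lra.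
Qed.

(** * Summation over an epoch *)

Lemma card_window N b (Q : pred 'I_N) :
  (forall i, Q i -> (b <= i < b + tau)%N) -> (#|Q| <= tau)%N.
Proof.
move=> Qb; rewrite cardE -(size_map val) -[leqRHS](size_iota b tau).
apply: uniq_leq_size; first by rewrite (map_inj_uniq val_inj) enum_uniq.
by move=> _ /mapP[i + ->]; rewrite mem_enum mem_iota => /Qb.
Qed.

(** Each index belongs to at most [tau] pairs as the earlier member and to at most [tau] as the
    later one. *)
Lemma window_sum N (G : nat -> R) : (forall i, 0 <= G i) ->
  \sum_(j < N) \sum_(i < j | (j <= i + tau)%N) (G i + G j) <=
    2 * tau%:R * \sum_(j < N) G j.
Proof.
move=> G0.
have cst_le (Q : pred 'I_N) c : 0 <= c -> (#|Q| <= tau)%N ->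
    \sum_(i < N | Q i) c <= tau%:R * c.
  by move=> c0 Qt; rewrite sumr_const -[leLHS]mulr_natl ler_wpM2r// ler_nat.
have -> : \sum_(j < N) \sum_(i < j | (j <= i + tau)%N) (G i + G j) =
    \sum_(j < N) \sum_(i < N | (j <= i + tau)%N && (i < j)%N) (G i + G j).
  apply: eq_bigr => j _.
  rewrite (big_ord_widen_cond N (fun i => (j <= i + tau)%N) (fun i => G i + G j))//.
  exact: ltnW.
under eq_bigr do rewrite big_split/=.
rewrite big_split/= -mulrA [leRHS]mulr_natl mulr2n; apply: lerD; last first.
  rewrite mulr_sumr; apply: ler_sum => j _; apply: cst_le => //.
  (* Truncated subtraction starts the window at 0 when [j] is below [tau]. *)
  apply: (card_window _ (j - tau)) => i /andP[h1 h2]; lia.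
rewrite (exchange_big_dep xpredT)//= mulr_sumr; apply: ler_sum => i _.
apply: cst_le => //; apply: (card_window _ i.+1) => j /andP[h1 h2]; lia.
Qed.

Lemma telescope_descent (D g e : nat -> R) (c h : R) N :
  (forall j, (j < N)%N -> D j.+1 <= D j - c * g j + h * e j) ->
  D N + c * \sum_(j < N) g j <= D 0 + h * \sum_(j < N) e j.
Proof.
elim: N => [|N IH] H; first by rewrite !big_ord0 !mulr0 lexx.
have := IH (fun j jN => H j (ltnW jN)); have := H N (ltnSn N).
rewrite !big_ord_recr/= !mulrDr.
by move: (c * \sum_(j < N) _) (h * \sum_(j < N) _) => p q; lra.
Qed.

Lemma sqn_min_le x : sqn (x - xs) <= 2 / mu * (favg f x - favg f xs).
Proof.
have := strongly_convex_first_order mu (favg f) xs x (differentiable_favg f diff_f) sc_f.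
rewrite gradL grad_favg_min// dotp0l addr0.
move: (sqn _) (favg f x) (favg f xs) => q p r H.
have : mu / 2 * q <= p - r by lra.
have c0 : 0 < mu / 2 by rewrite divr_gt0.
by rewrite -ler_pdivlMl// invf_div.
Qed.

(** The final distance is discarded after telescoping, the initial one is bounded by the snapshot
    gap, and the energies by gaps. The sum of gaps thus occurs on both sides, to be absorbed by the
    choice of step size. *)
Lemma epoch_gap_sum k :
  2 * gamma * \sum_(j < m) gap (xhat K (k * m + j)) <=
  2 / mu * gap (xtilde K k) + gamma ^+ 2 * (1 + 2 * s * tau%:R) *
    (4 * L * (\sum_(j < m) gap (xhat K (k * m + j)) + m%:R * gap (xtilde K k))).
Proof.
set A := \sum_(j < m) _; have st := xtilde_simple k.
pose G j := energy (k * m + j).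
pose W j := G j + s * \sum_(i < j | (j <= i + tau)%N) (G i + G j).
have step : 2 * gamma * A <= dist k 0 + gamma ^+ 2 * \sum_(j < m) W j.
  apply: le_trans (telescope_descent (fun j => dist k j)
    (fun j => gap (xhat K (k * m + j))) W (2 * gamma) (gamma ^+ 2) m _).
    by rewrite lerDr; apply: Ex_ge0 => w; exact: sqn_ge0.
  by move=> j jm; exact: virtual_step.
have d0 : dist k 0 <= 2 / mu * gap (xtilde K k).
  rewrite gapE// -ExZ; last exact: gap_simple.
  apply: Ex_le => [||w].
  - exact: (simple_comp (fun x => sqn (x - xs)) _ (virtual_simple k 0)).
  - exact: (simple_comp (fun x => 2 / mu * (favg f x - favg f xs)) _ st).
  by rewrite /virtual big_ord0 scaler0 subr0; exact: sqn_min_le.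
have WG : \sum_(j < m) W j <= (1 + 2 * s * tau%:R) * \sum_(j < m) G j.
  rewrite /W big_split/= -mulr_sumr mulrDl mul1r lerD2l.
  rewrite [2 * s]mulrC -!mulrA; apply: ler_wpM2l; first exact: sqrtr_ge0.
  rewrite mulrA.
  by apply: window_sum => j; exact: energy_ge0.
have GA : \sum_(j < m) G j <= 4 * L * (A + m%:R * gap (xtilde K k)).
  have -> : A + m%:R * gap (xtilde K k) =
      \sum_(j < m) (gap (xhat K (k * m + j)) + gap (xtilde K k)).
    by rewrite big_split/= sumr_const card_ord mulr_natl.
  rewrite mulr_sumr; apply: ler_sum => j _.
  by have := energy_le (k * m + j); rewrite epoch_index.
apply: (le_trans step); apply: lerD => //.
rewrite -mulrA; apply: ler_wpM2l; first exact: sqr_ge0.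
by apply: (le_trans WG); exact: ler_wpM2l.
Qed.

Lemma gap_choice k :
  gap (xtilde K k.+1) = m%:R^-1 * \sum_(j < m) gap (xhat K (k * m + j)).
Proof.
have mn0 : m%:R != 0 :> R by rewrite pnatr_eq0 -lt0n.
rewrite sumrB sumr_const card_ord mulrBr -(mulr_natl (favg f xs)) mulKf//.
congr (_ - _).
pose Y (j : 'I_m) w := favg f (xhat K (k * m + j) w).
have -> : E (fun w => favg f (xtilde K k.+1 w)) = E (fun w => Y (chosen K k w) w).
  by congr Ex; apply/funext => w; rewrite (exec_epoch exK).
have sY j : simple (Y j) by exact: (simple_comp (favg f) _ (xhat_simple _)).
rewrite (Ex_uniform P (history K (k.+1 * m) (k.+1 * m) k.+1)).
- by rewrite ExZ ?Ex_sum//; exact: simple_sum.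
- exact: history_measurable.
- exact: rr_chosen rrK k.
- exact: rr_choice rrK k.
move=> j; apply: (simple_comp (favg f)); apply: history_xhat.
by rewrite mulSn addnC ltn_add2r.
Qed.

(** Let [A] be the sum of gaps and [g] the snapshot gap. From [gamma * m = 8 / mu] the initial
    distance costs [gamma * m * g / 4], and the bound on [a] leaves at most
    [gamma / 4 * (A + m * g)] for the energy; so [7 / 4 * A <= m * g / 2]. *)
Lemma epoch_contraction a k : 0 < a -> gamma = a / (4 * L) ->
  a * (4 * (1 + 2 * s * tau%:R)) <= 1 ->
  m%:R = 32 * (L / mu) / a ->
  gap (xtilde K k.+1) <= 2^-1 * gap (xtilde K k).
Proof.
move=> a0 gE aC mE; rewrite gap_choice.
have := epoch_gap_sum k.
set A := \sum_(j < m) _.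
have : 0 <= A by apply: sumr_ge0 => j _; apply: gap_ge0; exact: xhat_simple.
have := gap_ge0 _ (xtilde_simple k).
generalize A (gap (xtilde K k)) (1 + 2 * s * tau%:R) aC => {A} A g C aC' g0 A0 H.
have m0 : 0 < m%:R :> R by rewrite ltr0n.
have gamma_gt0 : 0 < gamma by rewrite gE divr_gt0// mulr_gt0.
have gm : gamma * m%:R = 8 / mu.
  by rewrite gE mE; field; rewrite !gt_eqF.
have gL : gamma * (4 * L) = a by rewrite gE; field; rewrite gt_eqF.
have : gamma ^+ 2 * C * (4 * L * (A + m%:R * g)) <= gamma / 4 * (A + m%:R * g).
  have -> : gamma ^+ 2 * C * (4 * L * (A + m%:R * g)) =
      (gamma * (4 * L) * C) * (gamma * (A + m%:R * g)) by ring.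
  rewrite gL [leRHS]mulrAC [leRHS]mulrC; apply: ler_wpM2r; last by lra.
  by apply: mulr_ge0 => //; apply: addr_ge0 => //; apply: mulr_ge0.
have -> : gamma / 4 * (A + m%:R * g) = (gamma * A + gamma * (m%:R * g)) / 4 by field.
move=> /(lerD (lexx (2 / mu * g))) /(le_trans H).
have -> : 2 / mu * g = gamma * (m%:R * g) / 4.
  by rewrite mulrA gm; field; rewrite gt_eqF.
move=> H2; rewrite ler_pdivrMl// -(ler_pM2l gamma_gt0); move: H2.
have -> : gamma * (m%:R * (2^-1 * g)) = gamma * (m%:R * g) / 2 by field.
have : 0 <= gamma * (m%:R * g) by apply: mulr_ge0 => //; exact: mulr_ge0.
by rewrite -(mulrA 2 gamma A); move: (gamma * A) (gamma * (m%:R * g)) => p q; lra.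
Qed.

End Run.

(** * Convergence rate *)

Lemma bernoulli_le (R : realDomainType) (x : R) N :
  0 <= x <= 1 -> 1 - N%:R * x <= (1 - x) ^+ N.
Proof.
move=> /andP[x0 x1]; elim: N => [|N IH]; first by rewrite mul0r subr0 expr0.
have y0 : 0 <= 1 - x by rewrite subr_ge0.
rewrite exprS; apply: le_trans (ler_wpM2l y0 IH).
have : 0 <= N%:R * (x * x) by rewrite !mulr_ge0.
have -> : (1 - x) * (1 - N%:R * x) = 1 - x - N%:R * x + N%:R * (x * x) by ring.
by rewrite -natr1 mulrDl mul1r; move: (N%:R * x) (N%:R * _) => p q; lra.
Qed.

(** The epoch size makes [a / (64 * kappa)] equal to [1 / (2 * m)]. The minimum [r] then satisfies
    [(2 * m + n) * r <= 2], and the factor 1/4 in the rate leaves a total loss of at most 1/2. *)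
Lemma half_le_rate_pow (R : realType) (n m : nat) (kappa a : R) :
  (0 < n)%N -> (0 < m)%N -> 0 < kappa -> 0 < a -> m%:R = 32 * kappa / a ->
  2^-1 <= (1 - rate n kappa a) ^+ (2 * m + n).
Proof.
move=> n0 m0 k0 a0 mE; have n1 : 1 <= n%:R :> R by rewrite ler1n.
have m1 : 1 <= m%:R :> R by rewrite ler1n.
have -> : rate n kappa a = 1 / 4 * Num.min n%:R^-1 (2 * m%:R)^-1.
  by rewrite /rate mE; congr (_ * Num.min _ _); field; rewrite !gt_eqF.
set r := Num.min _ _.
have rn : n%:R * r <= 1.
  by rewrite mulrC -ler_pdivlMr ?div1r ?ge_min ?lexx// (lt_le_trans ltr01).
have rm : 2 * m%:R * r <= 1.
  by rewrite mulrC -ler_pdivlMr ?div1r ?ge_min ?lexx ?orbT//; lra.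
have r0 : 0 <= r by rewrite le_min !invr_ge0 ler0n; lra.
have r1 : r <= 1 by apply: le_trans rn; rewrite ler_peMl.
apply: (@le_trans _ _ (1 - (2 * m + n)%:R * (1 / 4 * r))); last first.
  by apply: bernoulli_le; lra.
by rewrite natrD natrM mulrDl !(mulrCA _ (1 / 4)); lra.
Qed.

Theorem corollary17 (R : realType) (disp : measure_display)
  (T : measurableType disp) (P : probability T R)
  (d n m tau : nat) (f : 'I_n -> 'rV[R]_d -> R)
  (L mu kappa gamma a : R) (x0 xstar : 'rV[R]_d) (K : run T d n m) :
  (0 < d)%N -> (0 < n)%N -> (0 < m)%N -> 0 < mu ->
  (forall i, convex_function setT (f i)) ->
  (forall i x, differentiable (f i) x) ->
  (forall i, lipschitz_grad L (f i)) ->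
  strongly_convex mu (favg f) ->
  (forall x, favg f xstar <= favg f x) ->
  kappa = L / mu ->
  0 < a <= a_star (sparsity f) kappa tau ->
  gamma = a / (4 * L) ->
  m%:R = 32 * kappa / a ->
  kromagnon P f gamma x0 tau K ->
  forall k : nat,
    ('E_P[(fun w => favg f (xtilde K k w))] - (favg f xstar)%:E <=
     ((1 - rate n kappa a) ^+ (k * (2 * m + n))
        * (favg f x0 - favg f xstar))%:E)%E.
Proof.
move=> _ n0 m0 mu0 cf df lip sc xmin kE /andP[a0 a_le] gE mE [ex ov rr] k.
(* Positivity of [kappa], and from it that of [L], comes from [m * a = 32 * kappa]. *)
have kappa0 : 0 < kappa.
  have : 0 < m%:R * a :> R by rewrite mulr_gt0// ltr0n.
  by rewrite mE mulfVK ?gt_eqF// pmulr_rgt0.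
have L0 : 0 < L by rewrite -(divfK (lt0r_neq0 mu0) L) -kE mulr_gt0.
have gamma0 : 0 <= gamma by rewrite gE divr_ge0 ?ltW// mulr_gt0.
have aC : a * (4 * (1 + 2 * Num.sqrt (sparsity f) * tau%:R)) <= 1.
  have C0 : 0 < 1 + 2 * Num.sqrt (sparsity f : R) * tau%:R.
    by apply: ltr_wpDr => //; rewrite !mulr_ge0// sqrtr_ge0.
  (* This factor of the denominator of [a_star] is at least 1, so the bound on [a] passes to the
     remaining factors. *)
  have D1 : 1 <= 1 + tau%:R / (16 * kappa).
    by rewrite lerDl divr_ge0// mulr_ge0// ltW.
  have D0 := lt_le_trans ltr01 D1.
  move: a_le; rewrite /a_star ler_pdivlMr ?mulr_gt0// => H.
  apply: le_trans H; rewrite [leRHS]mulrA ler_peMr//.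
  by rewrite !mulr_ge0// ltW.
have sx j : simple_map measurable (xtilde K j).
  exact: (xtilde_simple _ _ _ _ m0 ex P rr).
have contract j : Ex P (fun w => favg f (xtilde K j.+1 w)) - favg f xstar <=
    2^-1 * (Ex P (fun w => favg f (xtilde K j w)) - favg f xstar).
  apply: (epoch_contraction _ _ _ _ m0 ex P rr L mu _ n0 gamma0 L0 mu0
    cf df lip sc xmin ov a) => //.
  by rewrite -kE.
rewrite expectation_simple; last exact: (simple_comp (favg f)).
rewrite -EFinB lee_fin; elim: k => [|k IH].
  rewrite mul0n expr0 mul1r.
  have -> : (fun w => favg f (xtilde K 0 w)) = fun=> favg f x0.
    by apply/funext => w; rewrite (exec_init ex).
  by rewrite Ex_cst.
have H := half_le_rate_pow _ _ _ _ _ n0 m0 kappa0 a0 mE.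
apply: le_trans (contract k) _.
rewrite mulSn exprD -mulrA; apply: le_trans (ler_wpM2l _ IH) _ => //.
(* The common factor is nonnegative because, by induction, it dominates a nonnegative gap. *)
apply: ler_wpM2r H; apply: le_trans IH; rewrite subr_ge0.
rewrite -(Ex_cst P (favg f xstar)); apply: Ex_le => //.
  exact: (simple_cst (sigma_algebra_measurable T)).
exact: (simple_comp (favg f)).
Qed.
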